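(* Let $M\in\mathbb{R}^{m\times n}$, $m\ge n$, be a full-rank matrix with polar decomposition $M=WH$, and let $\overline W\in\mathbb{R}^{m\times n}$, $\overline H\in\mathbb{R}^{n\times n}$ be given incoming gradients. Let $\overline M$ be the exact polar backward gradient at $M$ for $(\overline W,\overline H)$ (defined in the context). Then there exist constants $c>0$ and $\varepsilon_0>0$, depending only on $M,\overline W,\overline H$ (in particular, $c$ is independent of $\varepsilon$), such that the following holds for all $0<\varepsilon<\varepsilon_0$. Let $\widetilde M\in\mathbb{R}^{m\times n}$ be a full-rank matrix with $\|M-\widetilde M\|_F\le\varepsilon$ and with polar decomposition $\widetilde M=\widetilde W\widetilde H$, where $\widetilde H=\widetilde V\widetilde\Sigma\widetilde V^\top$ with $\widetilde V$ orthogonal and $\widetilde\Sigma=\operatorname{diag}(\widetilde\sigma_1,\dots,\widetilde\sigma_n)$. Define $$\widetilde H_\varepsilon^{-1}=\widetilde V\,\widetilde\Sigma\,(\widetilde\Sigma^2+\varepsilon^{1/2}I)^{-1}\,\widetilde V^\top,\qquad \widetilde B_\varepsilon=\left(\overline H-\widetilde H_\varepsilon^{-1}\widetilde M^\top\overline W\,\widetilde H_\varepsilon^{-1}\right)_{\mathrm{sym}},$$ $$\widetilde X_\varepsilon=\widetilde V\left[\frac{\widetilde\sigma_i+\widetilde\sigma_j}{(\widetilde\sigma_i+\widetilde\sigma_j)^2+\varepsilon^{1/4}}\,(\widetilde V^\top\widetilde B_\varepsilon\widetilde V)_{ij}\right]_{i,j=1}^n\widetilde V^\top.$$ Then the regularized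 gradient $\overline{\widetilde M}_\varepsilon=\overline W\,\widetilde H_\varepsilon^{-1}+2\widetilde M\widetilde X_\varepsilon$ satisfies $$\|\overline M-\overline{\widetilde M}_\varepsilon\|_F\le c\,\varepsilon^{1/4}.$$
   Context: The polar decomposition of $M\in\mathbb{R}^{m\times n}$, $m\ge n$, is $M=WH$ where $W^\top W=I_n$ and $H\in\mathbb{R}^{n\times n}$ is symmetric positive semidefinite (positive definite when $M$ has full rank). For square $A$, $A_{\mathrm{sym}}=\tfrac12(A+A^\top)$; $\|\cdot\|_F$ is the Frobenius norm. Note that $\widetilde H_\varepsilon^{-1}$ is just a symbol for the regularized inverse defined by the displayed formula. The exact polar backward gradient at the full-rank matrix $M=WH$ for incoming gradients $(\overline W,\overline H)$ is the gradient at $M$ of a scalar loss $\mathcal L(M)=\ell(W,H)$ whose partial gradients with respect to $W$ and $H$ are $\overline W$ and $\overline H$. It is given by $$\overline M=\overline W H^{-1}+2MX,$$ where $X$ is the unique solution of $HX+XH=\bigl(\overline H-W^\top\overline W H^{-1}\bigr)_{\mathrm{sym}}$. Equivalently, if $H=V\operatorname{diag}(\sigma_1,\dots,\sigma_n)V^\top$ with $V$ orthogonal, then $X=V\bigl[\tfrac{1}{\sigma_i+\sigma_j}(V^\top CV)_{ij}\bigr]_{i,j}V^\top$ with $C=(\overline H-W^\top\overline W H^{-1})_{\mathrm{sym}}$. *)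

(* Defs.v *)
From mathcomp Require Import all_boot all_order all_algebra.
From mathcomp Require Import all_classical all_reals all_analysis.

Set Implicit Arguments.
Unset Strict Implicit.
Unset Printing Implicit Defensive.

Import Order.TTheory GRing.Theory Num.Theory.
Import numFieldNormedType.Exports.

Local Open Scope ring_scope.

(* The norm that the library puts on matrices is the max norm. *)
Definition frobenius (R : realType) (m n : nat) (A : 'M[R]_(m, n)) : R :=
  Num.sqrt (\sum_i \sum_j A i j ^+ 2).

Definition frobenius_dot (R : realType) (m n : nat) (A B : 'M[R]_(m, n)) : R :=
  \sum_i \sum_j A i j * B i j.

Definition symmetric_part (R : realType) (n : nat) (A : 'M[R]_n) : 'M[R]_n :=
  2^-1 *: (A + A^T).

Definition positive_semidefinite (R : realType) (n : nat) (A : 'M[R]_n) : Prop :=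
  A^T = A /\ forall x : 'cV[R]_n, 0 <= (x^T *m A *m x) 0 0.

Definition polar_decomposition (R : realType) (m n : nat)
    (M W : 'M[R]_(m, n)) (H : 'M[R]_n) : Prop :=
  [/\ M = W *m H, W^T *m W = 1%:M & positive_semidefinite H].

(* Gradients are taken for the Frobenius inner product.  The loss [ell] lives on
   the ambient space of pairs (W, H), where H is not constrained to be symmetric;
   accordingly, [Hbar] need not be symmetric.  [L] is the loss as a function of
   M, i.e. [ell] composed with the polar decomposition; its values at
   rank-deficient matrices do not matter, full rank being an open condition. *)
Definition polar_backward_gradient (R : realType) (m n : nat)
    (M W : 'M[R]_(m, n)) (H : 'M[R]_n)
    (Wbar : 'M[R]_(m, n)) (Hbar : 'M[R]_n) (Mbar : 'M[R]_(m, n)) : Prop :=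
  exists (ell : 'M[R]_(m, n) * 'M[R]_n -> R) (L : 'M[R]_(m, n) -> R),
    [/\ forall N V K, \rank N = n -> polar_decomposition N V K ->
          L N = ell (V, K),
        is_diff (W, H) ell
          (fun D => frobenius_dot Wbar D.1 + frobenius_dot Hbar D.2)
      & is_diff M L (fun D => frobenius_dot Mbar D)].

(* In the definitions below, the symmetric matrix is V *m diag_mx s *m V^T. *)

Definition regularized_inverse (R : realType) (n : nat) (eps : R)
    (V : 'M[R]_n) (s : 'rV[R]_n) : 'M[R]_n :=
  V *m diag_mx s
    *m invmx (diag_mx s *m diag_mx s + (eps `^ (1 / 2))%:M) *m V^T.

Definition regularized_B (R : realType) (m n : nat) (eps : R)
    (M Wbar : 'M[R]_(m, n)) (Hbar V : 'M[R]_n) (s : 'rV[R]_n) : 'M[R]_n :=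
  let Hinv := regularized_inverse eps V s in
  symmetric_part (Hbar - Hinv *m M^T *m Wbar *m Hinv).

Definition regularized_X (R : realType) (m n : nat) (eps : R)
    (M Wbar : 'M[R]_(m, n)) (Hbar V : 'M[R]_n) (s : 'rV[R]_n) : 'M[R]_n :=
  let B := regularized_B eps M Wbar Hbar V s in
  V *m (\matrix_(i, j) ((s 0 i + s 0 j) / ((s 0 i + s 0 j) ^+ 2 + eps `^ (1 / 4))
                        * (V^T *m B *m V) i j)) *m V^T.

Definition regularized_gradient (R : realType) (m n : nat) (eps : R)
    (M Wbar : 'M[R]_(m, n)) (Hbar V : 'M[R]_n) (s : 'rV[R]_n) : 'M[R]_(m, n) :=
  Wbar *m regularized_inverse eps V s
    + 2 *: (M *m regularized_X eps M Wbar Hbar V s).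

(* Main.v *)
Require Import Defs.
From mathcomp Require Import all_boot all_order all_algebra.
From mathcomp Require Import all_classical all_reals all_analysis.
From mathcomp Require Import ring lra.

Set Implicit Arguments.
Unset Strict Implicit.
Unset Printing Implicit Defensive.

Import Order.TTheory GRing.Theory Num.Theory.
Import numFieldNormedType.Exports.

Local Open Scope ring_scope.

(** The gradient [Mbar] of a loss that factors through the polar decomposition
    is determined by testing it along two kinds of curves through [M = W H] on
    which the decomposition is explicit: [W (H + t S)] with [S] symmetric, and
    [Q(t) W H] with [Q(t)] a plane rotation.  Comparing derivatives at [0] gives
    the symmetric part of [W^T Mbar] and the symmetry of
    [Mbar M^T - Wbar W^T]; together they give
    [Mbar = Wbar H^-1 + 2 M X] with
    [H X + X H = sym (Hbar - W^T Wbar H^-1)] ([polar_gradient_formula]).  No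
    differentiability of the polar decomposition itself is involved.

    The perturbation estimate rests on one inequality ([sylvester_bound]): if
    [<E, H E> >= sigma |E|^2] for every [E] and [K] is positive semidefinite,
    then [sigma |E| <= |H E + E K|].  Let [beta = eps^(1/4)], so that
    [|M - Mt| <= beta^4].  The inequality enters at two places.
    - Applied to [E = H - Ht], for which [H E + E Ht = M^T M - Mt^T Mt], it gives
      [H - Ht = O(beta^4)].  In particular the spectrum of [Ht] stays away from
      [0] uniformly for small [eps].
    - On such a spectrum, replacing [1 / s] by [s / (s^2 + beta^2)] costs
      [O(beta^2)], so the regularized inverse is within [O(beta^2)] of [H^-1],
      and so is the regularized right-hand side [B] of the exact one.
      Replacing [1 / s] by [s / (s^2 + beta)] with [s = s_i + s_j] costs
      [O(beta)], so the regularized [Xt] solves [Ht Xt + Xt Ht = B] up to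
      [O(beta)].  Hence [H (X - Xt) + (X - Xt) H = O(beta)], and the inequality
      bounds [X - Xt] by [O(beta)], which is the dominant error.
    The same inequality makes the solution [X] of the Lyapunov equation unique.

    These orders are tracked by the predicate [dominated], which quantifies over
    all admissible perturbations at once; the uniformity of the final constant is
    therefore built in. *)

(** * Frobenius inner product and norm *)

Section Frobenius.
Variable R : realType.

Lemma frobenius_dotE m n (A B : 'M[R]_(m, n)) :
  frobenius_dot A B = \tr (A^T *m B).
Proof.
rewrite /frobenius_dot exchange_big /=; apply: eq_bigr => j _.
by rewrite mxE; apply: eq_bigr => i _; rewrite mxE.
Qed.

Lemma frobenius_dotC m n (A B : 'M[R]_(m, n)) :
  frobenius_dot A B = frobenius_dot B A.
Proof. by rewrite !frobenius_dotE -mxtrace_tr trmx_mul trmxK. Qed.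

Lemma frobenius_dotT m n (A B : 'M[R]_(m, n)) :
  frobenius_dot A^T B^T = frobenius_dot A B.
Proof.
by rewrite !frobenius_dotE trmxK -[RHS]mxtrace_tr trmx_mul trmxK mxtrace_mulC.
Qed.

Lemma frobenius_dotDr m n (A B C : 'M[R]_(m, n)) :
  frobenius_dot A (B + C) = frobenius_dot A B + frobenius_dot A C.
Proof. by rewrite !frobenius_dotE mulmxDr mxtraceD. Qed.

Lemma frobenius_dotZr m n a (A B : 'M[R]_(m, n)) :
  frobenius_dot A (a *: B) = a * frobenius_dot A B.
Proof. by rewrite !frobenius_dotE -scalemxAr mxtraceZ. Qed.

Lemma frobenius_dotNr m n (A B : 'M[R]_(m, n)) :
  frobenius_dot A (- B) = - frobenius_dot A B.
Proof. by rewrite -scaleN1r frobenius_dotZr mulN1r. Qed.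

Lemma frobenius_dotDl m n (A B C : 'M[R]_(m, n)) :
  frobenius_dot (A + B) C = frobenius_dot A C + frobenius_dot B C.
Proof. by rewrite !(frobenius_dotC _ C) frobenius_dotDr. Qed.

Lemma frobenius_dotZl m n a (A B : 'M[R]_(m, n)) :
  frobenius_dot (a *: A) B = a * frobenius_dot A B.
Proof. by rewrite !(frobenius_dotC _ B) frobenius_dotZr. Qed.

Lemma frobenius_dotNl m n (A B : 'M[R]_(m, n)) :
  frobenius_dot (- A) B = - frobenius_dot A B.
Proof. by rewrite !(frobenius_dotC _ B) frobenius_dotNr. Qed.

Lemma frobenius_dot_mull m n p (A : 'M[R]_(m, n)) (B : 'M[R]_(n, p)) C :
  frobenius_dot (A *m B) C = frobenius_dot B (A^T *m C).
Proof. by rewrite !frobenius_dotE trmx_mul mulmxA. Qed.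

Lemma frobenius_dot_mulr m n p (A : 'M[R]_(m, n)) (B : 'M[R]_(n, p)) C :
  frobenius_dot C (A *m B) = frobenius_dot (C *m B^T) A.
Proof.
by rewrite !frobenius_dotE trmx_mul trmxK mulmxA mxtrace_mulC mulmxA.
Qed.

Lemma frobenius_dot_delta m n (A : 'M[R]_(m, n)) i j :
  frobenius_dot A (delta_mx i j) = A i j.
Proof.
rewrite /frobenius_dot (bigD1 i) //= (bigD1 j) //= mxE !eqxx mulr1.
rewrite big1 => [|k /negPf kj]; last by rewrite mxE kj andbF mulr0.
rewrite big1 ?addr0 // => k /negPf ki.
by apply: big1 => l _; rewrite mxE ki mulr0.
Qed.

Lemma frobenius_ge0 m n (A : 'M[R]_(m, n)) : 0 <= frobenius A.
Proof. exact: sqrtr_ge0. Qed.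

Lemma sqr_frobenius m n (A : 'M[R]_(m, n)) :
  frobenius A ^+ 2 = frobenius_dot A A.
Proof.
rewrite sqr_sqrtr; last by do 2 (apply: sumr_ge0 => ? _); exact: sqr_ge0.
by do 2 apply: eq_bigr => ? _.
Qed.

Lemma frobenius_eq0 m n (A : 'M[R]_(m, n)) : frobenius A = 0 -> A = 0.
Proof.
move=> A0; have: frobenius_dot A A = 0 by rewrite -sqr_frobenius A0 expr0n.
have sq i j : 0 <= A i j * A i j by rewrite -expr2 sqr_ge0.
move/eqP; rewrite psumr_eq0 => [/allP z|i _]; last by apply: sumr_ge0.
apply/matrixP => i j; have /= := z i (mem_index_enum _).
rewrite psumr_eq0 // => /allP/(_ j (mem_index_enum _))/=.
by rewrite -expr2 sqrf_eq0 mxE => /eqP.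
Qed.

Lemma frobenius0 m n : frobenius (0 : 'M[R]_(m, n)) = 0.
Proof.
apply/eqP; rewrite -sqrf_eq0 sqr_frobenius; apply/eqP.
by apply: big1 => i _; apply: big1 => j _; rewrite mxE mul0r.
Qed.

Lemma frobeniusT m n (A : 'M[R]_(m, n)) : frobenius A^T = frobenius A.
Proof.
by apply/eqP; rewrite -(@eqrXn2 _ 2) ?frobenius_ge0 // !sqr_frobenius frobenius_dotT.
Qed.

Lemma frobeniusZ m n a (A : 'M[R]_(m, n)) :
  frobenius (a *: A) = `|a| * frobenius A.
Proof.
apply/eqP; rewrite -(@eqrXn2 _ 2) ?mulr_ge0 ?frobenius_ge0 // exprMn.
rewrite !sqr_frobenius frobenius_dotZl frobenius_dotZr real_normK ?num_real //.
by rewrite mulrA expr2.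
Qed.

Lemma frobeniusN m n (A : 'M[R]_(m, n)) : frobenius (- A) = frobenius A.
Proof. by rewrite -scaleN1r frobeniusZ normrN1 mul1r. Qed.

(** Cauchy-Schwarz, from the nonnegativity of the square norm of
    [frobenius B *: A - frobenius A *: B]. *)
Lemma frobenius_dot_le m n (A B : 'M[R]_(m, n)) :
  frobenius_dot A B <= frobenius A * frobenius B.
Proof.
have dot0 p q (C D : 'M[R]_(p, q)) : frobenius C = 0 -> frobenius_dot C D = 0.
  by move/frobenius_eq0 ->; rewrite -[0](scale0r 0) frobenius_dotZl mul0r.
have [/dot0 -> | A0] := eqVneq (frobenius A) 0.
  by rewrite mulr_ge0 ?frobenius_ge0.
have [B0 | B0] := eqVneq (frobenius B) 0.
  by rewrite frobenius_dotC dot0 // mulr_ge0 ?frobenius_ge0.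
have a0 : 0 < frobenius A by rewrite lt_def A0 frobenius_ge0.
have b0 : 0 < frobenius B by rewrite lt_def B0 frobenius_ge0.
have := sqr_ge0 (frobenius (frobenius B *: A - frobenius A *: B)).
rewrite sqr_frobenius !(frobenius_dotDl, frobenius_dotDr, frobenius_dotNl,
  frobenius_dotNr, frobenius_dotZl, frobenius_dotZr) -!sqr_frobenius.
rewrite (frobenius_dotC B A) => h.
rewrite -(ler_pM2l (mulr_gt0 a0 b0)).
nra.
Qed.

Lemma frobeniusD m n (A B : 'M[R]_(m, n)) :
  frobenius (A + B) <= frobenius A + frobenius B.
Proof.
rewrite -ler_sqr ?nnegrE ?addr_ge0 ?frobenius_ge0 //.
rewrite sqr_frobenius frobenius_dotDl !frobenius_dotDr -!sqr_frobenius.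
rewrite (frobenius_dotC B A) sqrrD; have := frobenius_dot_le A B; lra.
Qed.

(** Cauchy-Schwarz on each entry of the product, a dot product of a row of [A]
    with a column of [B]. *)
Lemma frobeniusM m n p (A : 'M[R]_(m, n)) (B : 'M[R]_(n, p)) :
  frobenius (A *m B) <= frobenius A * frobenius B.
Proof.
rewrite -ler_sqr ?nnegrE ?mulr_ge0 ?frobenius_ge0 // exprMn.
have rows q r (C : 'M[R]_(q, r)) :
    frobenius C ^+ 2 = \sum_i frobenius (row i C) ^+ 2.
  rewrite sqr_frobenius; apply: eq_bigr => i _; rewrite sqr_frobenius.
  by rewrite /frobenius_dot big_ord1; apply: eq_bigr => j _; rewrite !mxE.
rewrite [X in X <= _]sqr_frobenius (rows _ _ A) -(frobeniusT B) (rows _ _ B^T).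
rewrite mulr_suml; apply: ler_sum => i _; rewrite mulr_sumr.
apply: ler_sum => j _; rewrite -expr2 -exprMn.
have -> : (A *m B) i j = frobenius_dot (row i A) (row j B^T).
  by rewrite mxE /frobenius_dot big_ord1; apply: eq_bigr => k _; rewrite !mxE.
rewrite -[X in X <= _]real_normK ?num_real //.
rewrite ler_sqr ?nnegrE ?mulr_ge0 ?frobenius_ge0 //.
rewrite ler_norml frobenius_dot_le andbT lerNl -frobenius_dotNl.
by rewrite (le_trans (frobenius_dot_le _ _)) // frobeniusN.
Qed.

Lemma frobenius_entry_le m n (A : 'M[R]_(m, n)) i j : `|A i j| <= frobenius A.
Proof.
rewrite -ler_sqr ?nnegrE ?frobenius_ge0 // sqr_frobenius real_normK ?num_real //.
rewrite /frobenius_dot.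
have sq k l : 0 <= A k l * A k l by rewrite -expr2 sqr_ge0.
rewrite (bigD1 i) //= (bigD1 j) //= -expr2 -addrA lerDl addr_ge0 //.
  by apply: sumr_ge0.
by apply: sumr_ge0 => k _; apply: sumr_ge0.
Qed.

Lemma frobenius_le_entries m n (A : 'M[R]_(m, n)) (b : R) :
  0 <= b -> (forall i j, `|A i j| <= b) ->
  frobenius A <= Num.sqrt (n * m)%N%:R * b.
Proof.
move=> b0 Ab; rewrite -ler_sqr ?nnegrE ?mulr_ge0 ?sqrtr_ge0 ?frobenius_ge0 //.
rewrite sqr_frobenius exprMn sqr_sqrtr //.
apply: (@le_trans _ _ (\sum_(i < m) \sum_(j < n) b ^+ 2)).
  do 2 (apply: ler_sum => ? _).
  by rewrite -expr2 -real_normK ?num_real // ler_sqr ?nnegrE.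
by rewrite !sumr_const !card_ord -mulrnA mulr_natl.
Qed.

End Frobenius.

(** * Coercive symmetric matrices and Sylvester equations *)

Section Coercivity.
Variable R : realType.

(** [E] ranges over matrices of every width: columns give the usual bound on the
    quadratic form, square matrices the one used in Sylvester equations. *)
Definition coercive n (sigma : R) (H : 'M[R]_n) : Prop :=
  forall k (E : 'M[R]_(n, k)),
    sigma * frobenius E ^+ 2 <= frobenius_dot E (H *m E).

Lemma psd_frobenius_dot n k (H : 'M[R]_n) (E : 'M[R]_(n, k)) :
  positive_semidefinite H -> 0 <= frobenius_dot E (H *m E).
Proof.
case=> _ Hge0; rewrite frobenius_dotE; apply: sumr_ge0 => j _.
suff -> : (E^T *m (H *m E)) j j = ((col j E)^T *m H *m col j E) 0 0 by [].
rewrite -mulmxA !mxE; apply: eq_bigr => i _; rewrite !mxE; congr (_ * _).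
by apply: eq_bigr => l _; rewrite !mxE.
Qed.

Lemma coercive_psd n (H : 'M[R]_n) sigma :
  H^T = H -> 0 <= sigma -> coercive sigma H -> positive_semidefinite H.
Proof.
move=> HT s0 Hc; split=> // x.
have -> : (x^T *m H *m x) 0 0 = frobenius_dot x (H *m x).
  by rewrite frobenius_dotE mulmxA /mxtrace big_ord1.
by apply: le_trans (Hc _ x); rewrite mulr_ge0 // exprn_ge0 // frobenius_ge0.
Qed.

(** Coercivity is tested on the transposed kernel of [H], on which the quadratic
    form vanishes. *)
Lemma coercive_unit n (H : 'M[R]_n) sigma :
  H^T = H -> 0 < sigma -> coercive sigma H -> H \in unitmx.
Proof.
move=> HT s0 Hc; rewrite -row_free_unit -kermx_eq0.
have := Hc _ (kermx H)^T.
have -> : H *m (kermx H)^T = 0 by rewrite -{1}HT -trmx_mul mulmx_ker trmx0.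
rewrite -[X in frobenius_dot _ X](scale0r 0) frobenius_dotZr mul0r frobeniusT.
rewrite pmulr_rle0 // => k0.
have /eqP : frobenius (kermx H) ^+ 2 = 0.
  by apply/eqP; rewrite eq_le k0 sqr_ge0.
by rewrite sqrf_eq0 => /eqP/frobenius_eq0/eqP.
Qed.

Lemma coerciveD n (H S : 'M[R]_n) sigma :
  coercive sigma H -> coercive (sigma - frobenius S) (H + S).
Proof.
move=> Hc k E; rewrite mulmxDl frobenius_dotDr mulrBl lerD //.
rewrite lerNl -frobenius_dotNr (le_trans (frobenius_dot_le _ _)) // frobeniusN.
rewrite expr2 mulrA [leRHS]mulrC ler_wpM2l ?frobenius_ge0 //.
exact: frobeniusM.
Qed.

(** Positivity of [H] at [E - t *: H^-1 E] bounds the quadratic form of [H]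
    below by [2 t |E|^2 - t^2 <E, H^-1 E>]; a small [t] makes the first term
    win. *)
Lemma psd_unit_coercive n (H : 'M[R]_n) :
  positive_semidefinite H -> H \in unitmx ->
  exists2 sigma, 0 < sigma & coercive sigma H.
Proof.
move=> Hpsd Hu; have [HT _] := Hpsd.
pose h := frobenius (invmx H) + 1.
have h0 : 0 < h by rewrite ltr_wpDl ?frobenius_ge0.
exists h^-1; rewrite ?invr_gt0 // => k E.
have := psd_frobenius_dot (E - h^-1 *: (invmx H *m E)) Hpsd.
rewrite mulmxBr -scalemxAr (mulKVmx Hu).
rewrite !(frobenius_dotDl, frobenius_dotDr, frobenius_dotNl,
  frobenius_dotNr, frobenius_dotZl, frobenius_dotZr).
have -> : frobenius_dot (invmx H *m E) (H *m E) = frobenius_dot E E.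
  by rewrite frobenius_dot_mull trmx_inv HT mulKmx.
rewrite -sqr_frobenius => ge0.
have le1 : frobenius_dot (invmx H *m E) E <= h * frobenius E ^+ 2.
  rewrite (le_trans (frobenius_dot_le _ _)) // expr2 mulrA.
  rewrite ler_wpM2r ?frobenius_ge0 // (le_trans (frobeniusM _ _)) //.
  by rewrite ler_wpM2r ?frobenius_ge0 // lerDl.
have hV0 : 0 <= h^-1 ^+ 2 by rewrite exprn_ge0 // invr_ge0 ltW.
have := ler_wpM2l hV0 le1.
have -> : h^-1 ^+ 2 * (h * frobenius E ^+ 2) = h^-1 * frobenius E ^+ 2.
  by rewrite expr2 mulrA mulfVK ?gt_eqF.
rewrite expr2; lra.
Qed.

(** Pairing [E] with [H E + E K] gives [<E, H E> + <E^T, K E^T>], and the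
    second term is nonnegative. *)
Lemma sylvester_bound n (H K E : 'M[R]_n) sigma :
  0 < sigma -> coercive sigma H -> positive_semidefinite K ->
  frobenius E <= sigma^-1 * frobenius (H *m E + E *m K).
Proof.
move=> s0 Hc Kpsd; have [E0|E0] := eqVneq (frobenius E) 0.
  by rewrite E0 mulr_ge0 ?frobenius_ge0 // invr_ge0 ltW.
have Egt0 : 0 < frobenius E by rewrite lt_def E0 frobenius_ge0.
rewrite -(ler_pM2l s0) mulrA mulfV ?gt_eqF // mul1r -(ler_pM2l Egt0).
apply: le_trans (frobenius_dot_le _ _); rewrite frobenius_dotDr.
have -> : frobenius_dot E (E *m K) = frobenius_dot E^T (K *m E^T).
  by rewrite -[RHS]frobenius_dotT trmx_mul !trmxK; case: Kpsd => ->.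
have := Hc _ E; have := psd_frobenius_dot E^T Kpsd.
by rewrite expr2; lra.
Qed.

End Coercivity.

(** * The gradient through the polar decomposition *)

Section PolarGradient.
Variable R : realType.

(** The two coefficient functions cover both curves used below: [a = id], [b = 0]
    for the segment in a symmetric direction, and [a = sin], [b = cos - 1] for a
    rotation, whose second-order term [v] does not contribute. *)
Lemma is_derive_curve (V : normedModType R) (f df : V -> R) (x u v : V)
    (a b : R -> R) :
  is_diff x f df -> a 0 = 0 -> b 0 = 0 ->
  is_derive (0 : R) 1 a 1 -> is_derive (0 : R) 1 b 0 ->
  is_derive (0 : R) 1 (fun t => f (x + (a t *: u + b t *: v))) (df u).
Proof.
move=> fdf a0 b0 da db.
have isd (c : R -> R) (dc : R) (w : V) : is_derive (0 : R) 1 c dc ->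
    is_diff (0 : R) (fun t => c t *: w) (fun h => (h * dc) *: w).
  move=> [/derivable1_diffP cd cv].
  have dc' : is_diff (0 : R) c (fun h => h * dc).
    apply: DiffDef => //; rewrite diff1E // derive1E cv.
    by apply/funext => h; rewrite /GRing.scale.
  have := is_diff_comp dc' (is_diff_scalel (c 0) w).
  by [].
have dg := is_diffD (isd _ _ u da) (isd _ _ v db).
have dg' := is_diffD (is_diff_cst x (0 : R)) dg.
have fdf' :
    is_diff ((cst x + ((fun t => a t *: u) + (fun t => b t *: v))) (0 : R)) f df.
  by rewrite /= !fctE a0 b0 !scale0r !addr0.
have dF := is_diff_comp dg' fdf'.
have [Fd Fv] := dF.
apply: DeriveDef; first exact: diff_derivable.
by rewrite deriveE // Fv /= !fctE /= mulr1 mulr0 scale1r scale0r addr0 add0r.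
Qed.

Lemma mxrank_isometry_mul m n (W : 'M[R]_(m, n)) (H : 'M[R]_n) :
  W^T *m W = 1%:M -> H \in unitmx -> \rank (W *m H) = n.
Proof.
move=> WW Hu; rewrite mxrankMfree ?row_free_unit //.
apply/eqP; rewrite eqn_leq rank_leq_col /=.
by rewrite -[X in (X <= _)%N](mxrank1 R n) -WW mxrankM_maxr.
Qed.

Lemma polar_unit m n (M W : 'M[R]_(m, n)) (H : 'M[R]_n) :
  \rank M = n -> polar_decomposition M W H -> H \in unitmx.
Proof.
move=> Mn [MWH _ _]; rewrite -row_free_unit /row_free eqn_leq rank_leq_row /=.
by rewrite -[X in (X <= _)%N]Mn MWH mxrankM_maxr.
Qed.

(** When [A] is antisymmetric with [A^2 = - P] for a projector [P],
    [1 + s A + (c - 1) P] is the rotation with cosine [c] and sine [s] in the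
    range of [P] and the identity on its complement. *)
Lemma rotation_isometry m n (W : 'M[R]_(m, n)) (A P : 'M[R]_m) (c s : R) :
  W^T *m W = 1%:M -> A^T = - A -> P^T = P -> A *m A = - P ->
  P *m A = A -> A *m P = A -> P *m P = P -> c ^+ 2 + s ^+ 2 = 1 ->
  let V := W + (s *: (A *m W) + (c - 1) *: (P *m W)) in V^T *m V = 1%:M.
Proof.
move=> WW AT PT AA PA AP PP cs /=.
have -> : W + (s *: (A *m W) + (c - 1) *: (P *m W))
        = (1%:M + (s *: A + (c - 1) *: P)) *m W.
  by rewrite mulmxDl mul1mx mulmxDl -!scalemxAl.
suff Q1 : (1%:M + (s *: A + (c - 1) *: P))^T
    *m (1%:M + (s *: A + (c - 1) *: P)) = 1%:M.
  by rewrite trmx_mul -mulmxA (mulmxA _ _ W) Q1 mul1mx.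
rewrite !linearD !linearZ /= trmx1 AT PT.
rewrite !(mulmxDl, mulmxDr, mul1mx, mulmx1) -!scalemxAl !mulNmx.
rewrite AA PA AP PP; transitivity (1%:M + (c ^+ 2 + s ^+ 2 - 1) *: P).
  by apply/matrixP => i j; rewrite !mxE; ring.
by rewrite cs subrr scale0r addr0.
Qed.

Section Gradient.
Variables (m n : nat) (M W : 'M[R]_(m, n)) (H : 'M[R]_n).
Variables (Wbar : 'M[R]_(m, n)) (Hbar : 'M[R]_n) (Mbar : 'M[R]_(m, n)).
Hypotheses (Mn : \rank M = n) (MWH : polar_decomposition M W H).
Hypothesis grad : polar_backward_gradient M W H Wbar Hbar Mbar.

(** For small [t], [H + t S] is still positive definite by coercivity, so
    [W (H + t S)] is a polar decomposition of a full-rank matrix and the loss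
    along this segment can be read off [ell]. *)
Lemma gradient_symmetric_direction (S : 'M[R]_n) :
  S^T = S -> frobenius_dot Mbar (W *m S) = frobenius_dot Hbar S.
Proof.
move=> ST; have [ell [L [Lell dell dL]]] := grad; have [ME WW Hpsd] := MWH.
have [sigma s0 Hc] := psd_unit_coercive Hpsd (polar_unit Mn MWH).
have did : is_derive (0 : R) 1 id 1 by exact: is_derive_id.
have dcst := @is_derive_cst R R R 0 0 1.
have [_ <-] := is_derive_curve (W *m S) 0 dL erefl erefl did dcst.
have [_] := is_derive_curve (0, S) 0 dell erefl erefl did dcst.
rewrite /= -[X in frobenius_dot Wbar X](scale0r 0) frobenius_dotZr mul0r add0r.
move<-; apply: near_eq_derive.
near=> t.
have tS : frobenius (t *: S) < sigma.
  rewrite frobeniusZ (@le_lt_trans _ _ (`|t| * (frobenius S + 1))) //.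
    by rewrite ler_wpM2l // lerDl.
  rewrite -ltr_pdivlMr ?ltr_wpDl ?frobenius_ge0 //.
  near: t; apply: (@pseudometric_normed_Zmodule.nbhs0_lt R R).
  by rewrite divr_gt0 ?ltr_wpDl ?frobenius_ge0.
have HtT : (H + t *: S)^T = H + t *: S.
  by rewrite linearD linearZ /= ST; case: Hpsd => ->.
have Htc := coerciveD (t *: S) Hc.
have gap : 0 < sigma - frobenius (t *: S) by rewrite subr_gt0.
rewrite scaler0 addr0.
rewrite (_ : (W, H) + _ = (W, H + t *: S)); last first.
  by apply: injective_projections; rewrite /= ?scaler0 ?addr0.
apply: Lell; last first.
  split=> //; first by rewrite mulmxDr -scalemxAr -ME.
  exact: coercive_psd HtT (ltW gap) Htc.
rewrite {1}ME scalemxAr -mulmxDr mxrank_isometry_mul //.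
exact: coercive_unit HtT gap Htc.
Unshelve. all: by end_near.
Qed.

(** Rotating [W] in the coordinate plane [(i, j)] keeps it an isometry, so the
    derivatives of [L] and [ell] along this curve agree; this is the vanishing
    of the [(i, j)] entry of the antisymmetric part. *)
Lemma gradient_rotation_direction :
  (Mbar *m M^T - Wbar *m W^T)^T = Mbar *m M^T - Wbar *m W^T.
Proof.
have [ell [L [Lell dell dL]]] := grad; have [ME WW Hpsd] := MWH.
apply/matrixP => i j; rewrite mxE.
have [->//|ij] := eqVneq i j.
pose A : 'M[R]_m := delta_mx j i - delta_mx i j.
pose P : 'M[R]_m := delta_mx i i + delta_mx j j.
have deltaM (p q r u : 'I_m) :
    (delta_mx p q : 'M[R]_m) *m delta_mx r u = (q == r)%:R *: delta_mx p u.
  by rewrite mul_delta_mx_cond scaler_nat.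
have ji : (j == i) = false by rewrite eq_sym (negPf ij).
have AT : A^T = - A by rewrite linearB /= !trmx_delta opprB.
have PT : P^T = P by rewrite linearD /= !trmx_delta.
have prods := (mulmxDl, mulmxDr, mulNmx, mulmxN, deltaM, eqxx, ji, negPf ij,
  scale0r, scale1r, oppr0, addr0, add0r).
have AA : A *m A = - P by rewrite /A /P !prods opprD addrC.
have PA : P *m A = A by rewrite /A /P !prods addrC.
have AP : A *m P = A by rewrite /A /P !prods.
have PP : P *m P = P by rewrite /A /P !prods.
have AE : A = delta_mx j i - delta_mx i j by [].
clearbody A P.
have dcos : is_derive (0 : R) 1 (fun t => cos t - 1) 0.
  by apply: is_derive_eq; rewrite sin0 ?oppr0 ?addr0 ?subr0.
have dsin : is_derive (0 : R) 1 sin 1 by apply: is_derive_eq; rewrite cos0.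
have cos1 : cos (0 : R) - 1 = 0 by rewrite cos0 subrr.
have [_ eL] := is_derive_curve (A *m M) (P *m M) dL (sin0 R) cos1 dsin dcos.
have [_ ] := is_derive_curve (A *m W, 0) (P *m W, 0) dell
  (sin0 R) cos1 dsin dcos.
rewrite /= -[X in frobenius_dot Hbar X](scale0r 0) frobenius_dotZr mul0r addr0.
move=> eell.
have : frobenius_dot Mbar (A *m M) = frobenius_dot Wbar (A *m W).
  rewrite -eL -eell; apply: near_eq_derive; near=> t.
  rewrite (_ : (W, H) + _ =
     (W + (sin t *: (A *m W) + (cos t - 1) *: (P *m W)), H)); last first.
    by apply: injective_projections; rewrite /= ?scaler0 ?addr0.
  have NE : M + (sin t *: (A *m M) + (cos t - 1) *: (P *m M)) =
      (W + (sin t *: (A *m W) + (cos t - 1) *: (P *m W))) *m H.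
    by rewrite ME !mulmxDl -!scalemxAl !mulmxA.
  have VV := rotation_isometry WW AT PT AA PA AP PP (cos2Dsin2 t).
  apply: Lell; last by split.
  by rewrite NE mxrank_isometry_mul // (polar_unit Mn MWH).
rewrite !frobenius_dot_mulr => /eqP; rewrite -subr_eq0 -frobenius_dotNl.
rewrite -frobenius_dotDl AE frobenius_dotDr frobenius_dotNr !frobenius_dot_delta.
by rewrite subr_eq0 => /eqP.
Unshelve. all: by end_near.
Qed.

(** The polar backward formula.  Writing [Z = Mbar H - Wbar], the rotation
    condition says that [Z W^T] is symmetric, which forces [Z = W K] with [K]
    symmetric; the condition on symmetric directions is then the Lyapunov
    equation for [X = H^-1 K H^-1 / 2]. *)
Lemma polar_gradient_formula :
  exists2 X, Mbar = Wbar *m invmx H + 2 *: (M *m X)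
    & H *m X + X *m H = symmetric_part (Hbar - W^T *m Wbar *m invmx H).
Proof.
have [ME WW [HT _]] := MWH; have Hu := polar_unit Mn MWH.
pose Z := Mbar *m H - Wbar; pose K := Z^T *m W.
have ZW : W *m Z^T = Z *m W^T.
  have := gradient_rotation_direction.
  have -> : Mbar *m M^T - Wbar *m W^T = Z *m W^T.
    by rewrite ME trmx_mul HT mulmxBl mulmxA.
  by rewrite trmx_mul trmxK.
have ZE : Z = W *m K by rewrite mulmxA ZW -mulmxA WW mulmx1.
have KT : K^T = K by rewrite trmx_mul trmxK {1}ZE mulmxA WW mul1mx.
have MbarE : Mbar = Wbar *m invmx H + W *m K *m invmx H.
  by rewrite -mulmxDl -ZE addrC subrK mulmxK.
clearbody K.
pose X := 2^-1 *: (invmx H *m K *m invmx H).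
have two : 2 * 2^-1 = 1 :> R by rewrite mulfV.
have HX : H *m X = 2^-1 *: (K *m invmx H).
  by rewrite -scalemxAr !mulmxA mulmxV ?mul1mx.
have XH : X *m H = 2^-1 *: (invmx H *m K) by rewrite -scalemxAl mulmxKV.
exists X.
  rewrite MbarE; congr (_ + _).
  by rewrite ME -(mulmxA W H) HX -scalemxAr scalerA two scale1r mulmxA.
(* [Q] is orthogonal to every symmetric matrix, in particular to its own
   symmetric part, which must vanish. *)
pose Q := W^T *m Mbar - Hbar.
have Q0 : Q + Q^T = 0.
  have sQ : (Q + Q^T)^T = Q + Q^T by rewrite linearD /= trmxK addrC.
  have h : frobenius_dot Q (Q + Q^T) = 0.
    rewrite {1}/Q frobenius_dotDl frobenius_dotNl frobenius_dot_mull trmxK.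
    by rewrite gradient_symmetric_direction // subrr.
  apply: frobenius_eq0; apply/eqP; rewrite -sqrf_eq0 sqr_frobenius.
  by rewrite frobenius_dotDl -{2}sQ frobenius_dotT h addr0.
move: Q0; rewrite /Q MbarE mulmxDr !mulmxA WW mul1mx.
have KH : (K *m invmx H)^T = invmx H *m K by rewrite trmx_mul KT trmx_inv HT.
set G := W^T *m Wbar *m invmx H.
rewrite !linearB !linearD /= KH => Q0.
rewrite HX XH -scalerDr /symmetric_part linearB /=; congr (_ *: _).
apply/eqP; rewrite -subr_eq0 -{}Q0; apply/eqP.
by apply/matrixP => p q; rewrite !mxE; ring.
Qed.

End Gradient.

End PolarGradient.

(** * Stability of the polar factor *)

Section PolarPerturbation.
Variable R : realType.

Lemma polar_gram m n (M W : 'M[R]_(m, n)) (H : 'M[R]_n) :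
  polar_decomposition M W H -> H *m H = M^T *m M.
Proof.
by case=> -> WW [HT _]; rewrite trmx_mul HT mulmxA -(mulmxA H) WW mulmx1.
Qed.

(** The factors satisfy [H (H - K) + (H - K) K = M^T M - N^T N], a Sylvester
    equation to which coercivity of [H] applies. *)
Lemma polar_factor_lipschitz m n (M N W V : 'M[R]_(m, n)) (H K : 'M[R]_n) sigma :
  polar_decomposition M W H -> polar_decomposition N V K ->
  0 < sigma -> coercive sigma H -> frobenius (M - N) <= 1 ->
  frobenius (H - K) <= sigma^-1 * (2 * frobenius M + 1) * frobenius (M - N).
Proof.
move=> MWH NVK s0 Hc MN; have [_ _ Kpsd] := NVK.
have := sylvester_bound (H - K) s0 Hc Kpsd.
have -> : H *m (H - K) + (H - K) *m K
        = M^T *m (M - N) + (M - N)^T *m N.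
  rewrite [(M - N)^T]linearB /= !mulmxBr !mulmxBl (polar_gram MWH) (polar_gram NVK).
  by rewrite !addrA !subrK.
move=> le1; apply: (le_trans le1); rewrite -mulrA.
apply: ler_wpM2l; first by rewrite invr_ge0 ltW.
have N_le : frobenius N <= frobenius M + 1.
  rewrite -[N](subKr M) (le_trans (frobeniusD _ _)) // frobeniusN.
  by rewrite lerD2l.
rewrite (le_trans (frobeniusD _ _)) //.
have := frobeniusM M^T (M - N); have := frobeniusM (M - N)^T N.
rewrite !frobeniusT.
have := ler_wpM2l (frobenius_ge0 (M - N)) N_le; lra.
Qed.

Lemma frobenius_isometry n (V : 'M[R]_n) :
  V^T *m V = 1%:M -> frobenius V = Num.sqrt n%:R.
Proof.
move=> VV; apply/eqP; rewrite -(@eqrXn2 _ 2) ?frobenius_ge0 ?sqrtr_ge0 //.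
rewrite sqr_frobenius sqr_sqrtr //.
by rewrite frobenius_dotE VV mxtrace1.
Qed.

(** The [i]-th column of [V] is a unit eigenvector for [s 0 i]. *)
Lemma coercive_spectrum n (H V : 'M[R]_n) (s : 'rV[R]_n) sigma i :
  coercive sigma H -> V^T *m V = 1%:M -> H = V *m diag_mx s *m V^T ->
  sigma <= s 0 i.
Proof.
move=> Hc VV HE; have := Hc _ (col i V).
have colE' (A : 'M[R]_n) : frobenius_dot (col i V) (A *m col i V)
    = (V^T *m A *m V) i i.
  rewrite frobenius_dotE /mxtrace big_ord1 -mulmxA mxE [RHS]mxE.
  apply: eq_bigr => k _; rewrite !mxE; congr (_ * _).
  by apply: eq_bigr => l _; rewrite !mxE.
rewrite sqr_frobenius -[X in frobenius_dot _ X]mul1mx !colE' mulmx1 VV.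
rewrite HE !mulmxA VV mul1mx -mulmxA VV mulmx1 !mxE eqxx mulr1n.
by rewrite mulr1.
Qed.

Lemma regularized_inverseE n (eps : R) (V : 'M[R]_n) (s : 'rV[R]_n) :
  (forall i, s 0 i ^+ 2 + eps `^ (1 / 2) != 0) ->
  regularized_inverse eps V s =
  V *m diag_mx (\row_i (s 0 i / (s 0 i ^+ 2 + eps `^ (1 / 2)))) *m V^T.
Proof.
move=> nz; rewrite /regularized_inverse.
set D := diag_mx s; set D' := diag_mx (\row_i _); set E := _ + _%:M.
have EE : E = diag_mx (\row_i (s 0 i ^+ 2 + eps `^ (1 / 2))).
  by apply/matrixP => i j; rewrite /E mulmx_diag !mxE -mulrnDl expr2.
have Eu : E \in unitmx.
  rewrite unitmxE EE det_diag unitfE; apply/prodf_neq0 => i _.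
  by rewrite mxE.
suff DE : D = D' *m E by rewrite DE -!mulmxA (mulmxA E) mulmxV // mul1mx.
rewrite EE mulmx_diag; congr diag_mx; apply/rowP => i.
by rewrite !mxE mulfVK.
Qed.

End PolarPerturbation.

(** * Uniform orders of magnitude *)

Section OrderOfMagnitude.
Variables (R : realType) (T : Type) (beta : T -> R).
Hypotheses (beta_gt0 : forall t, 0 < beta t) (beta_le1 : forall t, beta t <= 1).

(** [F = O(beta^k)], uniformly over the index type [T].  Recording the exponent
    turns products of error terms into additions of exponents. *)
Definition dominated k m n (F : T -> 'M[R]_(m, n)) : Prop :=
  exists2 K, 0 <= K & forall t, frobenius (F t) <= K * beta t ^+ k.

Lemma dominated_eq k m n (F G : T -> 'M[R]_(m, n)) :
  (forall t, F t = G t) -> dominated k F -> dominated k G.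
Proof. by move=> FG [K K0 FK]; exists K => // t; rewrite -FG. Qed.

Lemma dominated_cst m n (A : 'M[R]_(m, n)) : dominated 0 (fun=> A).
Proof. by exists (frobenius A) => [|t]; rewrite ?frobenius_ge0 // mulr1. Qed.

Lemma dominatedW k l m n (F : T -> 'M[R]_(m, n)) :
  (k <= l)%N -> dominated l F -> dominated k F.
Proof.
move=> kl [K K0 FK]; exists K => // t; apply: (le_trans (FK t)).
apply: ler_wpM2l => //; apply: ler_wiXn2l kl => //; exact: ltW.
Qed.

Lemma dominatedD k m n (F G : T -> 'M[R]_(m, n)) :
  dominated k F -> dominated k G -> dominated k (fun t => F t + G t).
Proof.
move=> [K K0 FK] [L L0 GL]; exists (K + L) => [|t]; first exact: addr_ge0.
by rewrite (le_trans (frobeniusD _ _)) // mulrDl lerD.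
Qed.

Lemma dominatedZ k m n a (F : T -> 'M[R]_(m, n)) :
  dominated k F -> dominated k (fun t => a *: F t).
Proof.
move=> [K K0 FK]; exists (`|a| * K) => [|t]; first by rewrite mulr_ge0.
by rewrite frobeniusZ -mulrA ler_wpM2l.
Qed.

Lemma dominatedN k m n (F : T -> 'M[R]_(m, n)) :
  dominated k F -> dominated k (fun t => - F t).
Proof. by case=> K K0 FK; exists K => // t; rewrite frobeniusN. Qed.

Lemma dominatedB k m n (F G : T -> 'M[R]_(m, n)) :
  dominated k F -> dominated k G -> dominated k (fun t => F t - G t).
Proof. by move=> dF dG; apply: dominatedD => //; exact: dominatedN. Qed.

Lemma dominatedT k m n (F : T -> 'M[R]_(m, n)) :
  dominated k F -> dominated k (fun t => (F t)^T).
Proof. by case=> K K0 FK; exists K => // t; rewrite frobeniusT. Qed.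

Lemma dominatedM k l m n p (F : T -> 'M[R]_(m, n)) (G : T -> 'M[R]_(n, p)) :
  dominated k F -> dominated l G -> dominated (k + l) (fun t => F t *m G t).
Proof.
move=> [K K0 FK] [L L0 GL]; exists (K * L) => [|t]; first exact: mulr_ge0.
by rewrite (le_trans (frobeniusM _ _)) // exprD mulrACA ler_pM ?frobenius_ge0.
Qed.

Lemma dominated_entries k m n c (F G : T -> 'M[R]_(m, n)) : 0 <= c ->
  (forall t i j, `|F t i j| <= c * beta t ^+ k * `|G t i j|) ->
  dominated 0 G -> dominated k F.
Proof.
move=> c0 FG [K K0 GK]; exists (Num.sqrt (n * m)%N%:R * (c * K)) => [|t].
  by rewrite !mulr_ge0 ?sqrtr_ge0.
have b0 : 0 <= beta t ^+ k by rewrite exprn_ge0 // ltW.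
rewrite -mulrA frobenius_le_entries // ?mulr_ge0 // => i j.
rewrite (le_trans (FG t i j)) // [leRHS]mulrAC ler_wpM2l ?mulr_ge0 //.
by rewrite (le_trans (frobenius_entry_le _ _ _)) // -[K]mulr1 -(expr0 (beta t)).
Qed.

(** Boundedness of an approximation comes for free from its error bound, so in
    products only errors have to be estimated. *)
Lemma dominated_limit k m n (A : 'M[R]_(m, n)) (F : T -> 'M[R]_(m, n)) :
  dominated k (fun t => A - F t) -> dominated 0 F.
Proof.
move=> /(dominatedW (leq0n k)) AF.
apply: (@dominated_eq _ _ _ (fun t => A - (A - F t))) => [t|].
  by rewrite subKr.
exact: dominatedB (dominated_cst A) AF.
Qed.

Lemma dominated_mul_limit k m n p (A : 'M[R]_(m, n)) (B : 'M[R]_(n, p)) F G :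
  dominated k (fun t => A - F t) -> dominated k (fun t => B - G t) ->
  dominated k (fun t => A *m B - F t *m G t).
Proof.
move=> AF BG; apply: (@dominated_eq _ _ _
  (fun t => (A - F t) *m B + F t *m (B - G t))) => [t|].
  by rewrite mulmxBl mulmxBr addrA subrK.
apply: dominatedD; last exact: (dominatedM (dominated_limit AF) BG).
by rewrite -[k]addn0; apply: dominatedM AF (dominated_cst B).
Qed.

End OrderOfMagnitude.

(** * Error of the regularized gradient *)

Section RegularizedGradient.
Variables (R : realType) (m n : nat).

(** The spectral gap [delta] is a field because, near a full-rank matrix, it
    holds automatically with a uniform [delta]. *)
Record nearby_polar (M : 'M[R]_(m, n)) (delta : R) := NearbyPolar {
  np_eps : R;
  np_mx : 'M[R]_(m, n);
  np_isometry : 'M[R]_(m, n);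
  np_factor : 'M[R]_n;
  np_basis : 'M[R]_n;
  np_spectrum : 'rV[R]_n;
  np_eps_gt0 : 0 < np_eps;
  np_eps_le1 : np_eps <= 1;
  np_dist : frobenius (M - np_mx) <= np_eps;
  np_polar : polar_decomposition np_mx np_isometry np_factor;
  np_basis_isometry : np_basis^T *m np_basis = 1%:M;
  np_factorE : np_factor = np_basis *m diag_mx np_spectrum *m np_basis^T;
  np_gap : forall i, delta <= np_spectrum 0 i
}.

Variables (M W : 'M[R]_(m, n)) (H : 'M[R]_n) (delta : R).
Variables (Wbar : 'M[R]_(m, n)) (Hbar X : 'M[R]_n).
Hypotheses (MWH : polar_decomposition M W H) (Hunit : H \in unitmx).
Hypothesis delta_gt0 : 0 < delta.
Hypothesis XE :
  H *m X + X *m H = symmetric_part (Hbar - W^T *m Wbar *m invmx H).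

Local Notation T := (nearby_polar M delta).
Let beta (t : T) : R := np_eps t `^ (1 / 4).
Local Notation dominated := (dominated beta).

Lemma beta_gt0 t : 0 < beta t.
Proof. by rewrite powR_gt0 // np_eps_gt0. Qed.

Lemma betaX (t : T) k : beta t ^+ k = np_eps t `^ (k%:R / 4).
Proof.
by rewrite -powR_mulrn ?powR_ge0 // -powRrM mulrC mul1r.
Qed.

Lemma beta_le1 t : beta t <= 1.
Proof.
have e01 : 0 < np_eps t <= 1 by rewrite np_eps_gt0 np_eps_le1.
by rewrite -(powRr0 (np_eps t)) ger_powR // divr_ge0.
Qed.

Local Notation G t := (regularized_inverse (np_eps t) (np_basis t) (np_spectrum t)).
Local Notation B t :=
  (regularized_B (np_eps t) (np_mx t) Wbar Hbar (np_basis t) (np_spectrum t)).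
Local Notation Xt t :=
  (regularized_X (np_eps t) (np_mx t) Wbar Hbar (np_basis t) (np_spectrum t)).

Lemma spectrum_gt0 (t : T) i : 0 < np_spectrum t 0 i.
Proof. exact: lt_le_trans (np_gap t i). Qed.

Lemma dominated_mx : dominated 4 (fun t : T => M - np_mx t).
Proof.
exists 1 => // t; rewrite mul1r betaX divff // powRr1 ?np_dist //.
exact/ltW/np_eps_gt0.
Qed.

Lemma dominated_factor : dominated 4 (fun t : T => H - np_factor t).
Proof.
have [_ _ Hpsd] := MWH; have [sigma s0 Hc] := psd_unit_coercive Hpsd Hunit.
exists (sigma^-1 * (2 * frobenius M + 1)) => [|t].
  by rewrite mulr_ge0 ?invr_ge0 ?(ltW s0) // addr_ge0 // mulr_ge0 ?frobenius_ge0.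
have d1 : frobenius (M - np_mx t) <= 1 := le_trans (np_dist t) (np_eps_le1 t).
apply: le_trans (polar_factor_lipschitz MWH (np_polar t) s0 Hc d1) _.
apply: ler_wpM2l.
  by rewrite mulr_ge0 ?invr_ge0 ?(ltW s0) // addr_ge0 // mulr_ge0 ?frobenius_ge0.
rewrite betaX divff // powRr1 ?np_dist //; exact/ltW/np_eps_gt0.
Qed.

Lemma dominated_basis : dominated 0 (fun t : T => np_basis t).
Proof.
exists (Num.sqrt n%:R) => [|t]; rewrite ?sqrtr_ge0 // mulr1.
by rewrite frobenius_isometry // np_basis_isometry.
Qed.

Lemma dominated_conj k (F : T -> 'M[R]_n) : dominated k F ->
  dominated k (fun t => np_basis t *m F t *m (np_basis t)^T).
Proof.
move=> dF; rewrite -[k]addn0.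
exact: dominatedM (dominatedM dominated_basis dF) (dominatedT dominated_basis).
Qed.

Lemma basis_conjM (t : T) (D D' : 'M[R]_n) :
  (np_basis t *m D *m (np_basis t)^T) *m (np_basis t *m D' *m (np_basis t)^T)
  = np_basis t *m (D *m D') *m (np_basis t)^T.
Proof.
rewrite !mulmxA; congr (_ *m _ *m _).
by rewrite -(mulmxA (np_basis t *m D)) np_basis_isometry mulmx1.
Qed.

Lemma basis_unitary (t : T) : np_basis t *m (np_basis t)^T = 1%:M.
Proof. exact/mulmx1C/np_basis_isometry. Qed.

Lemma regularized_den_gt0 (t : T) i :
  0 < np_spectrum t 0 i ^+ 2 + np_eps t `^ (1 / 2).
Proof. by rewrite ltr_wpDr ?powR_ge0 // exprn_gt0 // spectrum_gt0. Qed.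

Lemma regularized_inverse_npE (t : T) : G t = np_basis t
  *m diag_mx (\row_i (np_spectrum t 0 i
       / (np_spectrum t 0 i ^+ 2 + np_eps t `^ (1 / 2)))) *m (np_basis t)^T.
Proof.
by rewrite regularized_inverseE // => i; rewrite gt_eqF // regularized_den_gt0.
Qed.

Lemma dominated_diag k (c : R) (d : T -> 'rV[R]_n) : 0 <= c ->
  (forall t i, `|d t 0 i| <= c * beta t ^+ k) ->
  dominated k (fun t => diag_mx (d t)).
Proof.
move=> c0 dc; apply: (@dominated_entries _ _ _ beta_gt0 _ _ _ c _ (fun=> 1%:M)) => //.
  move=> t i j; rewrite !mxE; case: eqVneq => [->|].
    by rewrite !mulr1n normr1 mulr1 dc.
  by rewrite !mulr0n normr0 mulr0.
exact: dominated_cst.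
Qed.

(** In the eigenbasis the difference is diagonal with entries
    [beta^2 / (s_i^2 + beta^2)], at most [beta^2 / delta^2]. *)
Lemma dominated_one_sub_inverse_factor :
  dominated 2 (fun t => 1%:M - G t *m np_factor t).
Proof.
pose d (t : T) := \row_i (np_eps t `^ (1 / 2)
  / (np_spectrum t 0 i ^+ 2 + np_eps t `^ (1 / 2))).
apply: (@dominated_eq _ _ _ _ _ _
  (fun t => np_basis t *m diag_mx (d t) *m (np_basis t)^T)) => [t|].
  rewrite np_factorE regularized_inverse_npE basis_conjM.
  have -> : 1%:M = np_basis t *m 1%:M *m (np_basis t)^T.
    by rewrite mulmx1 basis_unitary.
  rewrite -mulmxBl -mulmxBr mulmx_diag.
  congr (_ *m _ *m _); apply/matrixP => i j; rewrite !mxE.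
  have [->|_] := eqVneq i j; last by rewrite !mulr0n subrr.
  rewrite !mulr1n; have := regularized_den_gt0 t j; set s := np_spectrum t 0 j.
  by move=> den; field; rewrite gt_eqF.
apply: dominated_conj; apply: (@dominated_diag _ (delta ^- 2)).
  by rewrite invr_ge0 exprn_ge0 // ltW.
move=> t i; rewrite mxE betaX (_ : 2 / 4 = 1 / 2 :> R); last by field.
have e0 : 0 <= np_eps t `^ (1 / 2) by exact: powR_ge0.
rewrite ger0_norm; last by rewrite divr_ge0 // ltW // regularized_den_gt0.
rewrite [leRHS]mulrC ler_wpM2l // lef_pV2 ?posrE ?exprn_gt0 ?regularized_den_gt0 //.
rewrite (@le_trans _ _ (np_spectrum t 0 i ^+ 2)) ?lerDl //.
by rewrite ler_sqr ?nnegrE ?np_gap // ltW // spectrum_gt0.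
Qed.

Lemma dominated_inverse : dominated 0 (fun t => G t).
Proof.
apply: (@dominated_eq _ _ _ _ _ _ (fun t => np_basis t
  *m diag_mx (\row_i (np_spectrum t 0 i
       / (np_spectrum t 0 i ^+ 2 + np_eps t `^ (1 / 2)))) *m (np_basis t)^T)).
  by move=> t; rewrite regularized_inverse_npE.
apply: dominated_conj; apply: (@dominated_diag _ delta^-1).
  by rewrite invr_ge0 ltW.
move=> t i; rewrite mxE mulr1.
have s0 := spectrum_gt0 t i; have e0 := powR_ge0 (np_eps t) (1 / 2).
rewrite ger0_norm; last by rewrite divr_ge0 // ltW // regularized_den_gt0.
rewrite ler_pdivrMr ?regularized_den_gt0 // mulrC ler_pdivlMr //.
apply: (@le_trans _ _ (np_spectrum t 0 i ^+ 2)); last by rewrite lerDl.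
by rewrite expr2 ler_wpM2l ?np_gap // ltW.
Qed.

(** [1 - G H] splits as [(1 - G Ht) - G (H - Ht)]; multiplying on the right by
    [H^-1] avoids inverting [Ht]. *)
Lemma dominated_inverse_error : dominated 2 (fun t => invmx H - G t).
Proof.
apply: (@dominated_eq _ _ _ _ _ _ (fun t => ((1%:M - G t *m np_factor t)
    - G t *m (H - np_factor t)) *m invmx H)) => [t|].
  rewrite mulmxBr opprB addrA addrNK mulmxBl mul1mx.
  by rewrite -mulmxA mulmxV // mulmx1.
rewrite -[2%N]addn0; apply: dominatedM; last exact: dominated_cst.
apply: dominatedB; first exact: dominated_one_sub_inverse_factor.
apply: (dominatedW beta_gt0 beta_le1 (l := 4)) => //.
exact: dominatedM dominated_inverse dominated_factor.
Qed.

Lemma symmetric_partB (A C : 'M[R]_n) :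
  symmetric_part A - symmetric_part C = symmetric_part (A - C).
Proof. by apply/matrixP => i j; rewrite !mxE; ring. Qed.

Lemma dominated_symmetric_part k (F : T -> 'M[R]_n) :
  dominated k F -> dominated k (fun t => symmetric_part (F t)).
Proof.
by move=> dF; exact: dominatedZ (dominatedD dF (dominatedT dF)).
Qed.

(** The isometry factor of the perturbed matrix never has to be estimated,
    because [W^T = H^-1 M^T]. *)
Lemma dominated_B_error : dominated 2 (fun t =>
  symmetric_part (Hbar - W^T *m Wbar *m invmx H) - B t).
Proof.
have WE : W^T = invmx H *m M^T.
  by have [-> _ [HT _]] := MWH; rewrite trmx_mul HT mulKmx.
apply: (@dominated_eq _ _ _ _ _ _ (fun t => symmetric_part
    (- (invmx H *m M^T *m Wbar *m invmx H - G t *m (np_mx t)^T *m Wbar *m G t))))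
    => [t|].
  rewrite WE /regularized_B symmetric_partB; congr symmetric_part.
  by apply/matrixP => i j; rewrite !mxE; ring.
apply: dominated_symmetric_part; apply: dominatedN.
have dM : dominated 2 (fun t : T => M^T - (np_mx t)^T).
  apply: (@dominated_eq _ _ _ _ _ _ (fun t => (M - np_mx t)^T)) => [t|].
    by rewrite linearB.
  exact: dominatedT (dominatedW beta_gt0 beta_le1 (l := 4) (k := 2) isT dominated_mx).
have dW : dominated 2 (fun t : T => Wbar - Wbar).
  by exists 0 => // t; rewrite subrr frobenius0 mul0r.
have dG := dominated_inverse_error.
have mul_limit := dominated_mul_limit beta_gt0 beta_le1.
exact: (mul_limit _ _ _ _ _ _ _ _ (mul_limit _ _ _ _ _ _ _ _
  (mul_limit _ _ _ _ _ _ _ _ dG dM) dW) dG).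
Qed.

Lemma dominated_B : dominated 0 (fun t => B t).
Proof. exact: (dominated_limit beta_gt0 beta_le1 (k := 2) dominated_B_error). Qed.

Lemma dominated_B_conj :
  dominated 0 (fun t => (np_basis t)^T *m B t *m np_basis t).
Proof.
exact: dominatedM (dominatedM (dominatedT dominated_basis) dominated_B)
  dominated_basis.
Qed.

Lemma spectrum_sum_ge (t : T) i j :
  delta <= np_spectrum t 0 i + np_spectrum t 0 j.
Proof. by rewrite (le_trans (np_gap t i)) // lerDl ltW // spectrum_gt0. Qed.

Lemma lyapunov_den_gt0 (t : T) i j :
  0 < (np_spectrum t 0 i + np_spectrum t 0 j) ^+ 2 + np_eps t `^ (1 / 4).
Proof.
by rewrite ltr_wpDr ?powR_ge0 // exprn_gt0 // addr_gt0 // spectrum_gt0.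
Qed.

Lemma dominated_X : dominated 0 (fun t => Xt t).
Proof.
apply: dominated_conj.
apply: (@dominated_entries _ _ _ beta_gt0 _ _ _ delta^-1 _ _ _ _ dominated_B_conj).
  by rewrite invr_ge0 ltW.
move=> t i j; rewrite mxE normrM mulr1 ler_wpM2r //.
have s0 := lt_le_trans delta_gt0 (spectrum_sum_ge t i j).
have e0 := powR_ge0 (np_eps t) (1 / 4); have den := lyapunov_den_gt0 t i j.
rewrite ger0_norm; last by rewrite divr_ge0 // ltW.
rewrite ler_pdivrMr // mulrC ler_pdivlMr //.
apply: (@le_trans _ _ ((np_spectrum t 0 i + np_spectrum t 0 j) ^+ 2)).
  by rewrite expr2 ler_wpM2l ?spectrum_sum_ge // ltW.
by rewrite lerDl.
Qed.

(** In the eigenbasis the residual has entries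
    [beta / ((s_i + s_j)^2 + beta)] times those of [B]. *)
Lemma dominated_lyapunov_residual :
  dominated 1 (fun t => B t - (np_factor t *m Xt t + Xt t *m np_factor t)).
Proof.
pose Y (t : T) := \matrix_(i, j) (beta t
  / ((np_spectrum t 0 i + np_spectrum t 0 j) ^+ 2 + beta t)
  * ((np_basis t)^T *m B t *m np_basis t) i j).
apply: (@dominated_eq _ _ _ _ _ _
  (fun t => np_basis t *m Y t *m (np_basis t)^T)) => [t|].
  have -> : B t = np_basis t *m ((np_basis t)^T *m B t *m np_basis t)
      *m (np_basis t)^T.
    by rewrite !mulmxA basis_unitary mul1mx -mulmxA basis_unitary mulmx1.
  rewrite /regularized_X np_factorE !basis_conjM -mulmxDl -mulmxDr.
  rewrite -mulmxBl -mulmxBr; congr (_ *m _ *m _).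
  rewrite mul_diag_mx mul_mx_diag; apply/matrixP => i j; rewrite !mxE.
  rewrite /beta; have := lyapunov_den_gt0 t i j.
  by move=> den; field; rewrite gt_eqF.
apply: dominated_conj.
apply: (@dominated_entries _ _ _ beta_gt0 _ _ _ (delta ^- 2) _ _ _ _ dominated_B_conj).
  by rewrite invr_ge0 exprn_ge0 // ltW.
move=> t i j; rewrite mxE normrM ler_wpM2r //.
have den := lyapunov_den_gt0 t i j.
rewrite ger0_norm; last by rewrite divr_ge0 // ltW // beta_gt0.
rewrite mulrC ler_wpM2r ?(ltW (beta_gt0 t)) //.
rewrite lef_pV2 ?posrE ?exprn_gt0 //.
have s0 := lt_le_trans delta_gt0 (spectrum_sum_ge t i j).
apply: (@le_trans _ _ ((np_spectrum t 0 i + np_spectrum t 0 j) ^+ 2)).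
  by rewrite ler_sqr ?nnegrE ?spectrum_sum_ge // ltW.
by rewrite lerDl ltW // beta_gt0.
Qed.

(** [X - Xt] solves the Lyapunov equation of [H] with a right-hand side made of
    the error on [B], the residual above, and the error on [H] times [Xt]. *)
Lemma dominated_X_error : dominated 1 (fun t => X - Xt t).
Proof.
have [_ _ Hpsd] := MWH; have [sigma s0 Hc] := psd_unit_coercive Hpsd Hunit.
have [K K0 KE] : dominated 1 (fun t => H *m (X - Xt t) + (X - Xt t) *m H).
  pose C := symmetric_part (Hbar - W^T *m Wbar *m invmx H).
  apply: (@dominated_eq _ _ _ _ _ _ (fun t => (C - B t)
      + (B t - (np_factor t *m Xt t + Xt t *m np_factor t))
      - ((H - np_factor t) *m Xt t + Xt t *m (H - np_factor t)))) => [t|].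
    rewrite /C -XE !mulmxBl !mulmxBr.
    by apply/matrixP => i j; rewrite !mxE; ring.
  have dH := dominatedW beta_gt0 beta_le1 (l := 4) (k := 1) isT dominated_factor.
  apply: dominatedB; last first.
    apply: dominatedD; last exact: dominatedM dominated_X dH.
    exact: dominatedM dH dominated_X.
  apply: dominatedD dominated_lyapunov_residual.
  exact: (dominatedW beta_gt0 beta_le1 (l := 2) (k := 1) isT dominated_B_error).
exists (sigma^-1 * K) => [|t]; first by rewrite mulr_ge0 // invr_ge0 ltW.
rewrite (le_trans (sylvester_bound _ s0 Hc Hpsd)) // -mulrA.
by rewrite ler_wpM2l ?KE // invr_ge0 ltW.
Qed.

Lemma dominated_gradient_error : dominated 1 (fun t =>
  (Wbar *m invmx H + 2 *: (M *m X))
  - regularized_gradient (np_eps t) (np_mx t) Wbar Hbar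
      (np_basis t) (np_spectrum t)).
Proof.
apply: (@dominated_eq _ _ _ _ _ _ (fun t => Wbar *m (invmx H - G t)
    + 2 *: (M *m X - np_mx t *m Xt t))) => [t|].
  rewrite /regularized_gradient mulmxBr scalerBr.
  by apply/matrixP => i j; rewrite !mxE; ring.
apply: dominatedD.
  apply: (@dominatedM _ _ _ 0 1); first exact: dominated_cst.
  exact: (dominatedW beta_gt0 beta_le1 (l := 2) (k := 1) isT dominated_inverse_error).
apply: dominatedZ; apply: (dominated_mul_limit beta_gt0 beta_le1) dominated_X_error.
exact: (dominatedW beta_gt0 beta_le1 (l := 4) (k := 1) isT dominated_mx).
Qed.

End RegularizedGradient.

Theorem proposition5p2 (R : realType) (m n : nat) (hmn : (n <= m)%N)
    (M W : 'M[R]_(m, n)) (H : 'M[R]_n)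
    (M_full_rank : \rank M = n) (M_polar : polar_decomposition M W H)
    (Wbar : 'M[R]_(m, n)) (Hbar : 'M[R]_n) :
  exists c eps0 : R, [/\ 0 < c, 0 < eps0 &
    forall Mbar : 'M[R]_(m, n),
      polar_backward_gradient M W H Wbar Hbar Mbar ->
    forall eps : R, 0 < eps -> eps < eps0 ->
    forall (Mt Wt : 'M[R]_(m, n)) (Ht Vt : 'M[R]_n) (st : 'rV[R]_n),
      \rank Mt = n ->
      frobenius (M - Mt) <= eps ->
      polar_decomposition Mt Wt Ht ->
      Vt^T *m Vt = 1%:M ->
      Ht = Vt *m diag_mx st *m Vt^T ->
      frobenius (Mbar - regularized_gradient eps Mt Wbar Hbar Vt st)
        <= c * eps `^ (1 / 4)].
Proof.
have Hunit := polar_unit M_full_rank M_polar.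
have [_ _ Hpsd] := M_polar.
have [sigma s0 Hc] := psd_unit_coercive Hpsd Hunit.
(* The constant is chosen before the gradient, so [X] is taken from some
   gradient [Mbar0]; any other one yields a solution of the same Lyapunov
   equation, hence the same [X]. *)
have [[Mbar0 grad0]|nograd] :=
    pselect (exists Mbar, polar_backward_gradient M W H Wbar Hbar Mbar); last first.
  by exists 1, 1; split=> // Mbar grad; case: nograd; exists Mbar.
have [X _ XE] := polar_gradient_formula M_full_rank M_polar grad0.
have delta0 : 0 < sigma / 2 by rewrite divr_gt0.
have [K K0 KE] := dominated_gradient_error M_polar Hunit delta0 XE.
(* [kappa] is the Lipschitz constant of the factor [H]: below
   [sigma / 2 / kappa] the perturbed spectrum stays above [sigma / 2]. *)
pose kappa := sigma^-1 * (2 * frobenius M + 1).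
have kappa0 : 0 < kappa.
  by rewrite mulr_gt0 ?invr_gt0 // ltr_wpDl // mulr_ge0 ?frobenius_ge0.
(* [K + 1] rather than [K], to have a positive constant. *)
exists (K + 1), (Num.min 1 (sigma / 2 / kappa)); split.
- by rewrite ltr_wpDl.
- by rewrite lt_min ltr01 divr_gt0.
move=> Mbar grad eps e0; rewrite lt_min => /andP[e1 esmall].
move=> Mt Wt Ht Vt st _ Mte Mt_polar VV HtE.
have gap i : sigma / 2 <= st 0 i.
  have := coerciveD (- (H - Ht)) Hc; rewrite frobeniusN subKr => Htc.
  apply: le_trans (coercive_spectrum i Htc VV HtE).
  have MM1 : frobenius (M - Mt) <= 1 := le_trans Mte (ltW e1).
  have := polar_factor_lipschitz M_polar Mt_polar s0 Hc MM1.
  rewrite -/kappa => HHt.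
  have le2 : kappa * frobenius (M - Mt) <= sigma / 2.
    by rewrite mulrC -ler_pdivlMr // (le_trans Mte) // ltW.
  have := le_trans HHt le2; lra.
have {}KE := KE (NearbyPolar e0 (ltW e1) Mte Mt_polar VV HtE gap).
have [X' -> XE'] := polar_gradient_formula M_full_rank M_polar grad.
have -> : X' = X.
  apply/eqP; rewrite -subr_eq0; apply/eqP/frobenius_eq0/eqP.
  rewrite eq_le frobenius_ge0 andbT (le_trans (sylvester_bound _ s0 Hc Hpsd)) //.
  by rewrite mulmxBr mulmxBl addrACA -opprD XE XE' subrr frobenius0 mulr0.
by apply: (le_trans KE); rewrite /= expr1 mulrDl lerDl mulr_ge0 ?powR_ge0.
Qed.
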